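(* Let $b,\sigma$ satisfy the assumptions on the coefficients in the context (with Lipschitz constants $L_{bx},L_{b\mu},L_{\sigma x},L_{\sigma\mu}$), and suppose that there exists a constant $\gamma$ such that $$\langle b(x,\mu,a)-b(x',\mu,a),x-x'\rangle+\frac12|\sigma(x,\mu,a)-\sigma(x',\mu,a)|^2\le-\gamma|x-x'|^2$$ for all $x,x'\in\mathbb{R}^d$, $\mu\in\mathcal{P}_2(\mathbb{R}^d)$, $a\in A$, and $$\gamma-\left(L_{b\mu}+L_{\sigma x}L_{\sigma\mu}+\frac12L_{\sigma\mu}^2\right)>0.$$ Then there exists a constant $\eta>0$ such that $$\mathbb{E}\left[\langle b(\xi,\mathbb{P}_\xi,a)-b(\xi',\mathbb{P}_{\xi'},a),\xi-\xi'\rangle+\frac12|\sigma(\xi,\mathbb{P}_\xi,a)-\sigma(\xi',\mathbb{P}_{\xi'},a)|^2\right]\le-\eta\,\mathbb{E}\left[|\xi-\xi'|^2\right]$$ for every $a\in A$ and every pair of square integrable $\mathbb{R}^d$-valued random variables $\xi,\xi'$.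
   Context: $\mathcal{P}_2(\mathbb{R}^d)$ is the space of Borel probability measures on $\mathbb{R}^d$ with finite second moment, with the 2-Wasserstein distance $W_2$. For a matrix $\sigma$, $|\sigma|=(\mathrm{tr}(\sigma\sigma^T))^{1/2}$. $\mathbb{P}_\xi$ denotes the law of a random variable $\xi$; random variables are defined on a complete probability space $(\Omega,\mathcal{F},\mathbb{P})$ carrying an $m$-dimensional Brownian motion and an independent random variable uniformly distributed on $(0,1)$. $A$ is a Polish space with its Borel $\sigma$-algebra. Assumptions on coefficients. $b:\mathbb{R}^d\times\mathcal{P}_2(\mathbb{R}^d)\times A\to\mathbb{R}^d$ and $\sigma:\mathbb{R}^d\times\mathcal{P}_2(\mathbb{R}^d)\times A\to\mathbb{R}^{d\times m}$ are Borel measurable, continuous in $a$ for fixed $(x,\mu)$, and there are positive constants $L_{bx},L_{b\mu},L_{\sigma x},L_{\sigma\mu},M$ such that for all $x,x',\mu,\mu',a$: $|b(x,\mu,a)-b(x',\mu,a)|\le L_{bx}|x-x'|$, $|b(x,\mu,a)-b(x,\mu',a)|\le L_{b\mu}W_2(\mu,\mu')$, $|\sigma(x,\mu,a)-\sigma(x',\mu,a)|\le L_{\sigma x}|x-x'|$, $|\sigma(x,\mu,a)-\sigma(x,\mu',a)|\le L_{\sigma\mu}W_2(\mu,\mu')$, $|b(0,\delta_0,a)|+|\sigma(0,\delta_0,a)|\le M$. *)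

(* Defs.v *)
From HB Require Import structures.
From mathcomp Require Import all_boot all_order all_algebra.
From mathcomp Require Import all_classical all_reals all_analysis.
From mathcomp Require Import measurable_realfun.

Set Implicit Arguments.
Unset Strict Implicit.
Unset Printing Implicit Defensive.

Import Order.TTheory GRing.Theory Num.Theory.
Import numFieldNormedType.Exports.

Local Open Scope classical_set_scope.
Local Open Scope ring_scope.

(* The library norm on matrices is the sup norm; it induces the same topology
   and Borel sets as [frob]. For a column vector, [frob] is the Euclidean
   norm. *)
Definition frob (R : realType) (m n : nat) (A : 'M[R]_(m, n)) : R :=
  Num.sqrt (\tr (A *m A^T)).

Definition inner (R : realType) (d : nat) (x y : 'cV[R]_d) : R :=
  (x^T *m y) ord0 ord0.

HB.instance Definition _ (R : realType) (m n : nat) :=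
  @isMeasurable.Build (sigma_display (@open 'M[R]_(m, n))) 'M[R]_(m, n)
    <<s @open 'M[R]_(m, n) >> (@sigma_algebra0 _ setT _) (@sigma_algebraC _ _)
    (@sigma_algebra_bigcup _ setT _).

Lemma frob_sqr (R : realType) (m n : nat) (A : 'M[R]_(m, n)) :
  frob A ^+ 2 = \sum_i \sum_j A i j ^+ 2.
Proof.
have trE : \tr (A *m A^T) = \sum_i \sum_j A i j ^+ 2.
  apply: eq_bigr => i _; rewrite mxE; apply: eq_bigr => j _.
  by rewrite mxE expr2.
rewrite /frob trE sqr_sqrtr//; apply: sumr_ge0 => i _.
by apply: sumr_ge0 => j _; exact: sqr_ge0.
Qed.

Lemma measurable_coord (R : realType) (m n : nat) (i : 'I_m) (j : 'I_n) :
  measurable_fun setT (fun A : 'M[R]_(m, n) => A i j).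
Proof.
apply: (measurability _ (RGenOpens.measurableE R)).
move=> _ [_ [a [b ->]] <-].
rewrite setTI; apply: sub_sigma_algebra.
have /continuousP := @coord_continuous R m n i j.
by apply; exact: interval_open.
Qed.

Lemma measurable_frob_sqr (R : realType) (m n : nat) :
  measurable_fun setT (fun A : 'M[R]_(m, n) => (frob A ^+ 2)%:E).
Proof.
have -> : (fun A : 'M[R]_(m, n) => (frob A ^+ 2)%:E) =
    EFin \o (fun A : 'M[R]_(m, n) => \sum_i \sum_j A i j ^+ 2).
  by apply/funext => A; rewrite frob_sqr.
apply/measurable_EFinP; apply: measurable_sum => i; apply: measurable_sum => j.
apply: (@measurable_funX _ _ _ _ (fun A : 'M[R]_(m, n) => A i j)).
exact: measurable_coord.
Qed.

Record P2 (R : realType) (d : nat) := MkP2 {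
  P2_prob :> probability 'cV[R]_d R;
  P2_moment : (\int[P2_prob]_x (frob x ^+ 2)%:E < +oo)%E }.

Definition coupling (R : realType) (d : nat) (mu nu : P2 R d)
    (pi : probability ('cV[R]_d * 'cV[R]_d)%type R) : Prop :=
  forall S : set 'cV[R]_d, measurable S ->
    pi (fst @^-1` S) = mu S /\ pi (snd @^-1` S) = nu S.

(* The infimum is over a nonempty set (the product measure is a coupling) of
   finite values, so [fine] loses nothing. *)
Definition W2 (R : realType) (d : nat) (mu nu : P2 R d) : R :=
  Num.sqrt (fine (ereal_inf
    [set (\int[pi]_z (frob (z.1 - z.2) ^+ 2)%:E)%E | pi in coupling mu nu])).

HB.instance Definition _ (R : realType) (d : nat) := gen_eqMixin (P2 R d).
HB.instance Definition _ (R : realType) (d : nat) := gen_choiceMixin (P2 R d).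

Section W2_topology.
Variables (R : realType) (d : nat).

Definition W2_open (U : set (P2 R d)) : Prop :=
  forall mu, U mu ->
    exists2 r : R, 0 < r & [set nu | W2 mu nu < r] `<=` U.

Let W2_openT : W2_open setT. Proof. by move=> mu _; exists 1. Qed.

Let W2_openI : setI_closed W2_open.
Proof.
move=> U V oU oV mu [/oU[r r0 rU] /oV[s s0 sV]].
exists (Num.min r s); first by rewrite lt_min r0.
by move=> nu /=; rewrite lt_min => /andP[/rU ? /sV ?].
Qed.

Let W2_open_bigU (I : Type) (f : I -> set (P2 R d)) :
  (forall i, W2_open (f i)) -> W2_open (\bigcup_i f i).
Proof.
move=> of_ mu [i _ /of_[r r0 rf]]; exists r => // nu /rf fnu.
by exists i.
Qed.

HB.instance Definition _ :=
  isOpenTopological.Build (P2 R d) W2_openT W2_openI W2_open_bigU.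

End W2_topology.

Lemma dirac0_moment (R : realType) (d : nat) :
  (\int[\d_ (0%R : 'cV[R]_d)]_x (frob x ^+ 2)%:E < +oo)%E.
Proof.
rewrite integral_dirac//; last exact: measurable_frob_sqr.
by rewrite diracT mul1e ltry.
Qed.

Definition dirac0 (R : realType) (d : nat) : P2 R d :=
  @MkP2 R d \d_ (0 : 'cV[R]_d) (dirac0_moment R d).

Definition square_integrable (dO : measure_display) (Omega : measurableType dO)
    (R : realType) (P : probability Omega R) (d : nat)
    (X : {RV P >-> 'cV[R]_d}) : Prop :=
  ('E_P[(fun w => frob (X w) ^+ 2)%R] < +oo)%E.

Lemma law_moment (dO : measure_display) (Omega : measurableType dO)
    (R : realType) (P : probability Omega R) (d : nat)
    (X : {RV P >-> 'cV[R]_d}) :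
  square_integrable X ->
  (\int[distribution P X]_x (frob x ^+ 2)%:E < +oo)%E.
Proof.
rewrite /square_integrable unlock => X2.
rewrite ge0_integral_distribution//; first exact: measurable_frob_sqr.
by move=> x; rewrite lee_fin sqr_ge0.
Qed.

Definition law (dO : measure_display) (Omega : measurableType dO)
    (R : realType) (P : probability Omega R) (d : nat)
    (X : {RV P >-> 'cV[R]_d}) (X2 : square_integrable X) : P2 R d :=
  @MkP2 R d (distribution P X) (law_moment X2).

Definition polish (R : realType) (A : topologicalType) : Prop :=
  (exists2 D : set A, countable D & dense D) /\
  exists rho : A -> A -> R,
    [/\ forall x y, rho x y = 0 <-> x = y,
        forall x y, rho x y = rho y x,
        forall x y z, rho x z <= rho x y + rho y z,
        forall x (U : set A), nbhs x U <->
          exists2 e, 0 < e & [set y | rho x y < e] `<=` U &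
        forall u : nat -> A,
          (forall e, 0 < e -> exists N : nat, forall i j : nat,
             (N <= i)%N -> (N <= j)%N -> rho (u i) (u j) < e) ->
          exists l : A, u @ \oo --> l].

Definition borel_fun (X Y : topologicalType) (f : X -> Y) : Prop :=
  forall S : set Y, <<s @open Y >> S -> <<s @open X >> (f @^-1` S).

Section probability_space.
Variables (dO : measure_display) (Omega : measurableType dO) (R : realType).
Variable P : probability Omega R.

(* Product rule for the whole finite family; subfamilies are covered by taking
   [S i = setT]. *)
Definition independent_family (I : finType) (dT : measure_display)
    (T : measurableType dT) (X : I -> Omega -> T) : Prop :=
  forall S : I -> set T, (forall i, measurable (S i)) ->
    P (\bigcap_i (X i @^-1` S i)) = \big[*%E/1%E]_i P (X i @^-1` S i).

(* [W t] is relevant for [0 <= t] only. The second argument of [normal_prob]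
   is a standard deviation. *)
Record brownian_motion (m : nat) (W : R -> Omega -> 'cV[R]_m) : Prop := {
  bm_measurable : forall t, 0 <= t -> measurable_fun setT (W t);
  bm_start : {ae P, forall w, W 0 w = 0};
  bm_continuous :
    {ae P, forall w, {within `[0, +oo[, continuous (fun t : R => W t w)}};
  bm_independent_increments : forall (n : nat) (t : nat -> R),
    0 <= t 0%N -> (forall k, t k < t k.+1) ->
    independent_family (fun (k : 'I_n) w => W (t k.+1) w - W (t k) w);
  bm_independent_coordinates : forall s t : R, 0 <= s -> s < t ->
    independent_family (fun (i : 'I_m) w => (W t w - W s w) i ord0);
  bm_gaussian_increments : forall s t : R, 0 <= s -> s < t ->
    forall (i : 'I_m) (S : set R), measurable S ->
    P ((fun w => (W t w - W s w) i ord0) @^-1` S) =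
      normal_prob 0 (Num.sqrt (t - s)) S }.

Definition sigma_process (m : nat) (W : R -> Omega -> 'cV[R]_m) :
    set (set Omega) :=
  <<s [set E | exists t S, [/\ 0 <= t, measurable S & E = W t @^-1` S]] >>.

Record probability_basis (m : nat) (W : R -> Omega -> 'cV[R]_m)
    (U : Omega -> R) : Prop := {
  basis_complete : measure_is_complete P;
  basis_brownian : brownian_motion W;
  basis_measurable : measurable_fun setT U;
  basis_uniform : forall S : set R, measurable S ->
    P (U @^-1` S) = uniform_prob (@ltr01 R) S;
  basis_independent : forall (E : set Omega) (S : set R),
    sigma_process W E -> measurable S ->
    P (E `&` U @^-1` S) = (P E * P (U @^-1` S))%E }.

End probability_space.

Record coefficients (R : realType) (d m : nat) (A : topologicalType)
    (b : 'cV[R]_d -> P2 R d -> A -> 'cV[R]_d)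
    (sigma : 'cV[R]_d -> P2 R d -> A -> 'M[R]_(d, m))
    (Lbx Lbmu Lsx Lsmu M : R) : Prop := {
  b_borel : borel_fun (fun z : 'cV[R]_d * P2 R d * A => b z.1.1 z.1.2 z.2);
  sigma_borel :
    borel_fun (fun z : 'cV[R]_d * P2 R d * A => sigma z.1.1 z.1.2 z.2);
  b_continuous : forall x mu, continuous (b x mu);
  sigma_continuous : forall x mu, continuous (sigma x mu);
  Lbx_gt0 : 0 < Lbx;
  Lbmu_gt0 : 0 < Lbmu;
  Lsx_gt0 : 0 < Lsx;
  Lsmu_gt0 : 0 < Lsmu;
  M_gt0 : 0 < M;
  b_lip_x : forall x x' mu a,
    frob (b x mu a - b x' mu a) <= Lbx * frob (x - x');
  b_lip_mu : forall x mu mu' a,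
    frob (b x mu a - b x mu' a) <= Lbmu * W2 mu mu';
  sigma_lip_x : forall x x' mu a,
    frob (sigma x mu a - sigma x' mu a) <= Lsx * frob (x - x');
  sigma_lip_mu : forall x mu mu' a,
    frob (sigma x mu a - sigma x mu' a) <= Lsmu * W2 mu mu';
  coef_bound : forall a,
    frob (b 0 (dirac0 R d) a) + frob (sigma 0 (dirac0 R d) a) <= M }.

(* Main.v *)
Require Import Defs.
From HB Require Import structures.
From mathcomp Require Import all_boot all_order all_algebra.
From mathcomp Require Import all_classical all_reals all_analysis.
From mathcomp Require Import measurable_realfun.
From mathcomp Require Import ring lra.

Set Implicit Arguments.
Unset Strict Implicit.
Unset Printing Implicit Defensive.

Import Order.TTheory GRing.Theory Num.Theory.
Import numFieldNormedType.Exports.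

Local Open Scope classical_set_scope.
Local Open Scope ring_scope.

(** The algebraic part is pointwise. Writing [mu] and [mu'] for the
    laws of [xi] and [xi'], [D = xi - xi'] and [w = W2 mu mu'], split each coefficient increment into an increment in [x]
    with the law frozen at [mu] and an increment in the law. The former is
    handled by the dissipativity hypothesis; the two cross terms
    [inner (b x' mu a - b x' mu' a) D] and the product of the two increments of
    [sigma] are bounded by Young's inequality, with weights chosen so that they
    contribute at most [(Lbmu + Lsx * Lsmu) * (|D|^2 + w^2) / 2]. The result
    ([dissipative_increment_le]) is an upper bound affine in [|D|^2].

    The probabilistic part is [W2_law_le]: the joint law of [(xi, xi')] is a
    coupling of the two marginal laws, so [w^2 <= E |D|^2]. Taking expectations
    gives the claim with [eta] equal to the positive gap
    [gamma - (Lbmu + Lsx * Lsmu + Lsmu ^+ 2 / 2)]. *)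

Section frobenius_norm.
Variable R : realType.

Lemma frob_ge0 (m n : nat) (A : 'M[R]_(m, n)) : 0 <= frob A.
Proof. exact: sqrtr_ge0. Qed.

Lemma frobN (m n : nat) (A : 'M[R]_(m, n)) : frob (- A) = frob A.
Proof. by rewrite /frob linearN /= mulNmx mulmxN opprK. Qed.

Lemma innerDl (d : nat) (x y z : 'cV[R]_d) :
  inner (x + y) z = inner x z + inner y z.
Proof. by rewrite /inner linearD /= mulmxDl mxE. Qed.

Lemma young_le (c s t : R) : 0 < c ->
  s * t <= 2^-1 * (c^-1 * s ^+ 2 + c * t ^+ 2).
Proof.
move=> c0; rewrite -subr_ge0.
have -> : 2^-1 * (c^-1 * s ^+ 2 + c * t ^+ 2) - s * t
    = 2^-1 * c^-1 * (s - c * t) ^+ 2.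
  by field; rewrite gt_eqF.
by rewrite mulr_ge0 ?sqr_ge0// mulr_ge0// invr_ge0 ltW.
Qed.

Lemma inner_young (d : nat) (c : R) (x y : 'cV[R]_d) : 0 < c ->
  inner x y <= 2^-1 * (c^-1 * frob x ^+ 2 + c * frob y ^+ 2).
Proof.
move=> c0; rewrite /inner mxE !frob_sqr !mulr_sumr -big_split mulr_sumr /=.
apply: ler_sum => i _; rewrite !big_ord1 mxE; exact: young_le.
Qed.

Lemma frob_sqrD_young (m n : nat) (c : R) (A B : 'M[R]_(m, n)) : 0 < c ->
  frob (A + B) ^+ 2 <= (1 + c) * frob A ^+ 2 + (1 + c^-1) * frob B ^+ 2.
Proof.
move=> c0; rewrite !frob_sqr !mulr_sumr -big_split /=; apply: ler_sum => i _.
rewrite !mulr_sumr -big_split /=; apply: ler_sum => j _; rewrite mxE.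
have := young_le (B i j) (A i j) c0.
set s := A i j; set t := B i j => st; nra.
Qed.

End frobenius_norm.

(** Monotonicity without measurability: the integral is a difference of two
    suprema over simple functions, each monotone in the integrand. It spares
    the measurability of the coefficients composed with the random variables. *)
Lemma le_integral_pointwise (dT : measure_display) (T : measurableType dT)
    (R : realType) (mu : {measure set T -> \bar R}) (f g : T -> \bar R) :
  (forall x, f x <= g x)%E ->
  (\int[mu]_x f x <= \int[mu]_x g x)%E.
Proof.
move=> fg; rewrite /integral !patch_setT; apply: leeB.
  apply: ereal_sup_le => _ [h hf <-]; exists h => // x.
  apply: (le_trans (hf x)).
  exact: (@funepos_le _ _ setT f g (in1W fg) x (in_setT x)).
apply: ereal_sup_le => _ [h hg <-]; exists h => // x.
apply: (le_trans (hg x)).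
exact: (@funeneg_le _ _ setT f g (in1W fg) x (in_setT x)).
Qed.

Section joint_law.
Variables (dO : measure_display) (Omega : measurableType dO) (R : realType).
Variables (P : probability Omega R) (d : nat).

(** The pair [(X, Y)] as a random variable for the product sigma-algebra. *)
Definition pair_rv (X Y : {RV P >-> 'cV[R]_d}) (w : Omega) :
  ('cV[R]_d * 'cV[R]_d)%type := (X w, Y w).

Lemma measurable_pair_rv (X Y : {RV P >-> 'cV[R]_d}) :
  measurable_fun setT (pair_rv X Y).
Proof. exact: measurable_fun_pair. Qed.

HB.instance Definition _ (X Y : {RV P >-> 'cV[R]_d}) :=
  isMeasurableFun.Build _ _ _ _ (pair_rv X Y) (measurable_pair_rv X Y).

Lemma measurable_frob_sqrB (n : nat) : measurable_fun setT
  (fun z : 'cV[R]_n * 'cV[R]_n => (frob (z.1 - z.2) ^+ 2)%:E).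
Proof.
under eq_fun do rewrite frob_sqr.
apply/measurable_EFinP; apply: measurable_sum => i; apply: measurable_sum => j.
under eq_fun do rewrite !mxE.
apply: measurable_funX; apply: measurable_funB.
  exact: (measurableT_comp (@measurable_coord R n 1 i j) measurable_fst).
exact: (measurableT_comp (@measurable_coord R n 1 i j) measurable_snd).
Qed.

Variables (X Y : {RV P >-> 'cV[R]_d}).
Hypotheses (X2 : square_integrable X) (Y2 : square_integrable Y).

Lemma measurable_frob_sqr_rvB :
  measurable_fun setT (fun w => (frob (X w - Y w) ^+ 2)%:E).
Proof.
exact: (measurableT_comp (@measurable_frob_sqrB d) (measurable_pair_rv X Y)).
Qed.

Lemma frob_sqr_rvB_lty : (\int[P]_w (frob (X w - Y w) ^+ 2)%:E < +oo)%E.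
Proof.
move: X2 Y2; rewrite /square_integrable unlock => X2' Y2'.
have mX2 : measurable_fun setT (fun w => (frob (X w) ^+ 2)%:E).
  exact: (measurableT_comp (@measurable_frob_sqr R d 1)).
have mY2 : measurable_fun setT (fun w => (frob (Y w) ^+ 2)%:E).
  exact: (measurableT_comp (@measurable_frob_sqr R d 1)).
apply: (@le_lt_trans _ _ (\int[P]_w
    (2%:E * (frob (X w) ^+ 2)%:E + 2%:E * (frob (Y w) ^+ 2)%:E))%E).
  apply: le_integral_pointwise => w; rewrite -!EFinM -EFinD lee_fin.
  have := frob_sqrD_young (X w) (- Y w) (@ltr01 R).
  by rewrite invr1 frobN.
rewrite ge0_integralD//; first last.
- by apply: measurable_funeM.
- by move=> w _; rewrite mule_ge0// lee_fin sqr_ge0.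
- by apply: measurable_funeM.
- by move=> w _; rewrite mule_ge0// lee_fin sqr_ge0.
rewrite !ge0_integralZl//; [|by move=> w _; rewrite lee_fin sqr_ge0..].
by rewrite lte_add_pinfty// lte_mul_pinfty.
Qed.

Lemma coupling_joint_law :
  coupling (law X2) (law Y2) (distribution P (pair_rv X Y)).
Proof. by []. Qed.

(** The infimum defining [W2] is at most the cost of the joint law. That cost is
    finite, so taking the real part of the infimum preserves the inequality. *)
Lemma W2_law_le :
  ((W2 (law X2) (law Y2) ^+ 2)%:E <= \int[P]_w (frob (X w - Y w) ^+ 2)%:E)%E.
Proof.
rewrite /W2; set S := [set _ | _ in _].
have S_le : (ereal_inf S <= \int[P]_w (frob (X w - Y w) ^+ 2)%:E)%E.
  apply: ereal_inf_lbound; exists (distribution P (pair_rv X Y)).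
    exact: coupling_joint_law.
  rewrite ge0_integral_distribution//; first exact: measurable_frob_sqrB.
  by move=> z; rewrite lee_fin sqr_ge0.
have S_ge0 : (0 <= ereal_inf S)%E.
  apply: le_ereal_inf_tmp => _ [pi _ <-].
  by apply: integral_ge0 => z _; rewrite lee_fin sqr_ge0.
rewrite sqr_sqrtr ?fine_ge0// fineK// ge0_fin_numE//.
exact: le_lt_trans S_le frob_sqr_rvB_lty.
Qed.

End joint_law.

(** The cross terms load both squares equally; the extra [Lsmu ^+ 2] in front
    of the [W2] term is the square of the law increment of [sigma]. *)
Lemma dissipative_increment_le (R : realType) (d m : nat)
    (A : topologicalType)
    (b : 'cV[R]_d -> P2 R d -> A -> 'cV[R]_d)
    (sigma : 'cV[R]_d -> P2 R d -> A -> 'M[R]_(d, m))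
    (Lbx Lbmu Lsx Lsmu M gamma : R) :
  coefficients b sigma Lbx Lbmu Lsx Lsmu M ->
  (forall (x x' : 'cV[R]_d) (mu : P2 R d) (a : A),
      inner (b x mu a - b x' mu a) (x - x')
        + 2^-1 * frob (sigma x mu a - sigma x' mu a) ^+ 2
      <= - gamma * frob (x - x') ^+ 2) ->
  forall (x x' : 'cV[R]_d) (mu mu' : P2 R d) (a : A),
    inner (b x mu a - b x' mu' a) (x - x')
      + 2^-1 * frob (sigma x mu a - sigma x' mu' a) ^+ 2
    <= (2^-1 * (Lbmu + Lsx * Lsmu) - gamma) * frob (x - x') ^+ 2
       + 2^-1 * (Lbmu + Lsx * Lsmu + Lsmu ^+ 2) * W2 mu mu' ^+ 2.
Proof.
move=> hcoef hdiss x x' mu mu' a.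
have Lb0 := Lbmu_gt0 hcoef; have Lx0 := Lsx_gt0 hcoef.
have Ls0 := Lsmu_gt0 hcoef.
have sqr_le (s t : R) : 0 <= s -> s <= t -> s ^+ 2 <= t ^+ 2.
  by move=> s0 st; rewrite ler_sqr ?nnegrE// (le_trans s0).
have hb := sqr_le _ _ (frob_ge0 _) (b_lip_mu hcoef x' mu mu' a).
have hsx := sqr_le _ _ (frob_ge0 _) (sigma_lip_x hcoef x x' mu a).
have hsmu := sqr_le _ _ (frob_ge0 _) (sigma_lip_mu hcoef x' mu mu' a).
have hd := hdiss x x' mu a.
(* Weight [Lbmu] for [b] and [Lsmu / Lsx] for [sigma] give [frob (x - x') ^+ 2]
   and [W2 mu mu' ^+ 2] the same coefficient in each cross term. *)
have c0 : 0 < Lsmu / Lsx by rewrite divr_gt0.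
rewrite -(subrKA (b x' mu a)) -(subrKA (sigma x' mu a)) innerDl.
move: hb hsx hsmu hd (inner_young (b x' mu a - b x' mu' a) (x - x') Lb0).
move: (frob_sqrD_young (sigma x mu a - sigma x' mu a)
  (sigma x' mu a - sigma x' mu' a) c0).
rewrite invf_div !exprMn.
set S := frob (_ + _) ^+ 2; set S1 := frob (sigma x mu a - _) ^+ 2.
set S2 := frob (sigma x' mu a - _) ^+ 2; set B := frob (b x' mu a - _) ^+ 2.
set D := frob (x - x') ^+ 2; set w := W2 mu mu' ^+ 2.
set I1 := inner (b x mu a - _) _; set I2 := inner (b x' mu a - _) _.
move=> hS hB hS1 hS2 hI1 hI2.
have eB : Lbmu^-1 * B <= Lbmu * w.
  by rewrite ler_pdivrMl// mulrA -expr2.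
have e1 : Lsmu / Lsx * S1 <= Lsx * Lsmu * D.
  rewrite mulrAC ler_pdivrMr//; nra.
have e2 : Lsx / Lsmu * S2 <= Lsx * Lsmu * w.
  rewrite mulrAC ler_pdivrMr//; nra.
lra.
Qed.

Theorem proposition3p3 (R : realType) (d m : nat)
    (dO : measure_display) (Omega : measurableType dO)
    (P : probability Omega R)
    (W : R -> Omega -> 'cV[R]_m) (U : Omega -> R)
    (hbasis : probability_basis P W U)
    (A : topologicalType) (hA : polish R A)
    (b : 'cV[R]_d -> P2 R d -> A -> 'cV[R]_d)
    (sigma : 'cV[R]_d -> P2 R d -> A -> 'M[R]_(d, m))
    (Lbx Lbmu Lsx Lsmu M : R)
    (hcoef : coefficients b sigma Lbx Lbmu Lsx Lsmu M)
    (gamma : R)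
    (hdiss : forall (x x' : 'cV[R]_d) (mu : P2 R d) (a : A),
      inner (b x mu a - b x' mu a) (x - x')
        + 2^-1 * frob (sigma x mu a - sigma x' mu a) ^+ 2
      <= - gamma * frob (x - x') ^+ 2)
    (hgamma : 0 < gamma - (Lbmu + Lsx * Lsmu + 2^-1 * Lsmu ^+ 2)) :
  exists2 eta : R, 0 < eta &
    forall (a : A) (xi xi' : {RV P >-> 'cV[R]_d})
      (hxi : square_integrable xi) (hxi' : square_integrable xi'),
      ('E_P[(fun w : Omega =>
          inner (b (xi w) (law hxi) a - b (xi' w) (law hxi') a) (xi w - xi' w)
          + 2^-1 * frob (sigma (xi w) (law hxi) a
                         - sigma (xi' w) (law hxi') a) ^+ 2)%R]
       <= (- eta)%:E * 'E_P[(fun w : Omega => frob (xi w - xi' w) ^+ 2)%R])%E.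
Proof.
set eta := gamma - _ in hgamma.
exists eta => // a xi xi' hxi hxi'; rewrite unlock.
set mu := law hxi; set mu' := law hxi'.
pose D w := (frob (xi w - xi' w) ^+ 2)%:E.
pose alpha := 2^-1 * (Lbmu + Lsx * Lsmu) - gamma.
pose beta := 2^-1 * (Lbmu + Lsx * Lsmu + Lsmu ^+ 2).
have beta0 : 0 <= beta.
  have Lb0 := Lbmu_gt0 hcoef; have Lx0 := Lsx_gt0 hcoef.
  by rewrite mulr_ge0// addr_ge0 ?sqr_ge0// addr_ge0 ?mulr_ge0 ?ltW//;
    exact: Lsmu_gt0 hcoef.
have D_lty := frob_sqr_rvB_lty hxi hxi'.
have D_ge0 : (0 <= \int[P]_w D w)%E.
  by apply: integral_ge0 => w _; rewrite lee_fin sqr_ge0.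
have D_fin : (\int[P]_w D w)%E \is a fin_num by rewrite ge0_fin_numE.
have D_int : P.-integrable setT D.
  apply/integrableP; split; first exact: measurable_frob_sqr_rvB.
  by under eq_integral do rewrite gee0_abs ?lee_fin ?sqr_ge0//.
apply: (@le_trans _ _
    (\int[P]_w (alpha%:E * D w + (beta * W2 mu mu' ^+ 2)%:E))%E).
  apply: le_integral_pointwise => w; rewrite -EFinM -EFinD lee_fin.
  exact: (dissipative_increment_le hcoef hdiss).
rewrite integralD//; last 2 first.
- exact: integrableZl.
- exact: (@finite_measure_integrable_cst _ _ _ P).
rewrite integralZl// integral_cst//= probability_setT mule1.
have := W2_law_le hxi hxi'; rewrite -/mu -/mu'.
have -> : (\int[P]_w (frob (xi w - xi' w) ^+ 2)%:E = \int[P]_w D w)%E by [].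
rewrite -(fineK D_fin) lee_fin => W_le.
rewrite -!EFinM -EFinD lee_fin.
(* [alpha + beta = - eta] *)
have := ler_wpM2l beta0 W_le; rewrite /eta /alpha /beta; lra.
Qed.
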